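(* Let $\kappa\le\lambda$ be cardinals and suppose that $\kappa$ is $2^\lambda$-strongly compact. For any forcing notion $\mathbb{Q}$ of cardinality $\leq\lambda$ the following are equivalent: (1) $\mathbb{Q}$ is $(\omega,\kappa)$-predistributive. (2) There is a $\kappa$-complete fine ultrafilter $\mathcal{U}$ over $P_\kappa(\lambda)$ such that $\mathbb{P}_{\mathcal{U}}$ projects into $\mathrm{RO}(\mathbb{Q})$.
   Context: Conventions: $q\le p$ means $q$ is stronger than $p$; $\mathbb{P}/p=\{q\in\mathbb{P}:q\le p\}$; $\mathbb{1}$ denotes the weakest condition; forcing posets are identified with their separative quotients; $\kappa$ is an uncountable cardinal. $\mathcal{F}(\mathbb{P})$ is the family (filter) of dense open (dense and downward closed) subsets of $\mathbb{P}$, and ${}^{<\kappa}\mathcal{F}(\mathbb{P})$ is the set of sequences of length $<\kappa$ from it. $\mathbb{P}$ is $(\omega,\kappa)$-predistributive if for each $p\in\mathbb{P}$ and each $\langle D_\alpha:\alpha<\gamma\rangle\in{}^{<\kappa}\mathcal{F}(\mathbb{P})$ there are $q\le p$ and a sequence $\langle d_n:n<\omega\rangle$ of members of $\mathcal{F}(\mathbb{P}/q)$ such that for each $\alpha<\gamma$ there is $n<\omega$ with $d_n\subseteq D_\alpha$. $P_\kappa(\mu)=\{x\subseteq\mu:|x|<\kappa\}$. For $x,y\in P_\kappa(\mu)$, $x\prec y$ iff $x\subseteq y$ and $|x|<|\kappa\cap y|$. An ultrafilter $\mathcal{U}$ over $P_\kappa(\mu)$ is fine if $\{x:\alpha\in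 x\}\in\mathcal{U}$ for all $\alpha<\mu$. $\kappa$ is $\mu$-strongly compact if there is a $\kappa$-complete fine ultrafilter over $P_\kappa(\mu)$. For a fine $\kappa$-complete ultrafilter $\mathcal{U}$ over $P_\kappa(\lambda)$, the strongly compact Prikry forcing $\mathbb{P}_{\mathcal{U}}$ consists of trees $T$ (ordered by end-extension) of finite $\prec$-increasing sequences of elements of $P_\kappa(\lambda)$ which have a stem $s\in T$, i.e. every $t\in T$ is comparable with $s$, and for every $t\in T$ end-extending (or equal to) $s$, $\{x\in P_\kappa(\lambda):t^\frown\langle x\rangle\in T\}\in\mathcal{U}$. The order is $T\le S$ iff $T\subseteq S$. $\mathrm{RO}(\mathbb{Q})$ is the regular open Boolean algebra of $\mathbb{Q}$ minus its least element. A projection $\pi:\mathbb{P}\to\mathbb{R}$ is an order-preserving map with $\pi(\mathbb{1}_{\mathbb{P}})=\mathbb{1}_{\mathbb{R}}$ such that for all $p\in\mathbb{P}$ and $r\le\pi(p)$ there is $p'\le p$ with $\pi(p')\le r$; $\mathbb{P}$ projects into $\mathbb{R}$ if such a map exists. *)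

(* Defs.v *)
From HB Require Import structures.
From mathcomp Require Import all_boot all_order.
From mathcomp Require Import boolp classical_sets functions cardinality filter.

Set Implicit Arguments.
Unset Strict Implicit.
Unset Printing Implicit Defensive.

Import Order.TTheory.

Local Open Scope classical_set_scope.
Local Open Scope card_scope.
Local Open Scope order_scope.

Definition card_lt T U (A : set T) (B : set U) : bool :=
  (A #<= B) && ~~ (B #<= A).
Notation "A '#<' B" := (card_lt A B)
  (at level 79, format "A  '#<'  B") : card_scope.

(** Ordinals are the elements of a fixed well-ordered type [O]; as in the von
    Neumann convention, the ordinal [a] is identified with the set [below a] of
    its predecessors, and cardinals are the initial ordinals. *)
Section Ordinals.
Context {d : Order.disp_t} {O : orderType d}.
Implicit Types (a b kappa mu : O) (x y : set O).

Definition below a : set O := [set b | b < a].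

Definition is_cardinal kappa : Prop :=
  forall a, a < kappa -> below a #< below kappa.

Definition uncountable_cardinal kappa : Prop :=
  is_cardinal kappa /\ ~ countable (below kappa).

Definition is_two_power mu a : Prop :=
  is_cardinal mu /\ below mu #= [set x : set O | x `<=` below a].

Definition Pk kappa mu : set (set O) :=
  [set x | x `<=` below mu /\ x #< below kappa].

Definition prec kappa x y : Prop :=
  x `<=` y /\ x #< (below kappa `&` y).

Definition fine kappa mu (U : set_system (Pk kappa mu)) : Prop :=
  forall a, a < mu -> U [set x | val x a].

Definition complete kappa T (U : set_system T) : Prop :=
  forall F : set (set T), F `<=` U -> F #< below kappa -> U (\bigcap_(A in F) A).

Definition fine_complete_ultrafilter kappa mu (U : set_system (Pk kappa mu))
    : Prop :=
  [/\ UltraFilter U, complete kappa U & fine U].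

Definition strongly_compact kappa mu : Prop :=
  exists U : set_system (Pk kappa mu), fine_complete_ultrafilter U.

End Ordinals.

(** [fle q p] means that [q] is stronger than [p]. *)
Record forcing := Forcing {
  cond :> Type;
  fle : cond -> cond -> Prop;
  fone : cond;
  fle_refl : forall p, fle p p;
  fle_trans : forall q p r, fle p q -> fle q r -> fle p r;
  fle_one : forall p, fle p fone
}.
Arguments fle {_}.
Arguments fone {_}.

Definition is_projection (P R : forcing) (pi : P -> R) : Prop :=
  [/\ forall p q, fle q p -> fle (pi q) (pi p),
      pi fone = fone &
      forall p r, fle r (pi p) -> exists2 p', fle p' p & fle (pi p') r].

Definition projects (P R : forcing) : Prop :=
  exists pi : P -> R, is_projection pi.

Section Forcing.
Variable P : forcing.
Implicit Types (p q r : P) (A D : set P).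

Definition compatible p q : Prop := exists2 r, fle r p & fle r q.

Definition cone p : set P := [set q | fle q p].

(** For [A = setT] this is the family of dense open subsets of [P], for
    [A = cone q] that of the dense open subsets of [P/q]. *)
Definition dense_open_in A : set (set P) :=
  [set D | [/\ D `<=` A,
               forall p, A p -> exists2 q, D q & fle q p &
               forall p q, D p -> A q -> fle q p -> D q]].

(** This notion depends on the presentation of [P]: a reversed ordinal of
    uncountable cofinality below [kappa] is not predistributive although its
    separative quotient is a point.  Forcing notions being identified with their
    separative quotients, it is meant to be applied to [sepquot P]. *)
Definition predistributive {d} {O : orderType d} (kappa : O) : Prop :=
  forall p (gamma : O) (D : O -> set P),
    gamma < kappa ->
    (forall a, a < gamma -> dense_open_in setT (D a)) ->
    exists q (e : nat -> set P),
      [/\ fle q p,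
          forall n, dense_open_in (cone q) (e n) &
          forall a, a < gamma -> exists n, e n `<=` D a].

(** Interior and closure for the topology whose open sets are the downward
    closed ones; [cone p] is the least neighbourhood of [p]. *)
Definition finterior A : set P := [set p | cone p `<=` A].
Definition fclosure A : set P := [set p | cone p `&` A !=set0].

Definition regular_open A : Prop := finterior (fclosure A) = A.

Definition RO_cond : set (set P) := [set A | regular_open A /\ A !=set0].

Lemma RO_one_subproof : setT \in RO_cond.
Proof.
rewrite inE; split; last by exists fone.
apply/seteqP; split=> // p _ q _; exists q; split=> //; exact: fle_refl.
Qed.

Definition RO : forcing :=
  @Forcing RO_cond (fun A B : RO_cond => val A `<=` val B)
    (exist _ setT RO_one_subproof)
    (fun A : RO_cond => @subset_refl _ (val A))
    (fun B A C : RO_cond => @subset_trans _ (val B) (val A) (val C))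
    (fun A : RO_cond => @subsetT _ (val A)).

(** [sep_le p q]: [p] forces [q] into the generic filter.  The elements of
    [sepquot] are the equivalence classes of this preorder. *)
Definition sep_le p q : Prop := forall r, fle r p -> compatible r q.

Definition sep_class p : set P := [set q | sep_le p q /\ sep_le q p].

Definition sepquot_cond : set (set P) := range sep_class.

Definition sepquot_le (C D : sepquot_cond) : Prop :=
  forall p q, val C p -> val D q -> sep_le p q.

Lemma sep_le_refl p : sep_le p p.
Proof. by move=> r rp; exists r => //; exact: fle_refl. Qed.

Lemma sep_le_trans q p r : sep_le p q -> sep_le q r -> sep_le p r.
Proof.
move=> pq qr s /pq[t ts /qr[u ut ur]].
by exists u => //; exact: fle_trans ut ts.
Qed.

Lemma sepquot_one_subproof : sep_class fone \in sepquot_cond.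
Proof. by rewrite inE; exists fone. Qed.

Lemma sepquot_refl_subproof (C : sepquot_cond) : sepquot_le C C.
Proof.
move: C => [C /[dup] + CP]; rewrite inE => -[c _ Cc] p q /=.
rewrite -Cc => -[_ pc] [cq _]; exact: sep_le_trans pc cq.
Qed.

Lemma sepquot_trans_subproof (D C E : sepquot_cond) :
  sepquot_le C D -> sepquot_le D E -> sepquot_le C E.
Proof.
move: D => [D DP] CD DE p q Cp Eq.
have [c Dc] : exists c, D c.
  by move: (DP); rewrite inE => -[c _ <-]; exists c; split; exact: sep_le_refl.
exact: sep_le_trans (CD p c Cp Dc) (DE c q Dc Eq).
Qed.

Lemma sepquot_le_one_subproof (C : sepquot_cond) :
  sepquot_le C (exist _ (sep_class fone) sepquot_one_subproof).
Proof.
move=> p q _ [oq _]; apply: sep_le_trans oq => r _.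
by exists r; [exact: fle_refl | exact: fle_one].
Qed.

Definition sepquot : forcing :=
  Forcing sepquot_refl_subproof sepquot_trans_subproof sepquot_le_one_subproof.

End Forcing.

Section Prikry.
Context {d : Order.disp_t} {O : orderType d}.
Variables (kappa lambda : O) (U : set_system (Pk kappa lambda)).
Implicit Types (s t : seq (Pk kappa lambda)) (T : set (seq (Pk kappa lambda))).

Definition increasing t : bool :=
  sorted (fun x y : Pk kappa lambda => `[< prec kappa (val x) (val y) >]) t.

Definition is_tree T : Prop :=
  (forall t, T t -> increasing t) /\
  (forall s t, T t -> prefix s t -> T s).

Definition is_stem T s : Prop :=
  [/\ T s,
      forall t, T t -> prefix s t || prefix t s &
      forall t, T t -> prefix s t -> U [set x | T (rcons t x)]].

Definition prikry_cond : set (set (seq (Pk kappa lambda))) :=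
  [set T | is_tree T /\ exists s, is_stem T s].

Hypothesis kl : kappa <= lambda.
Hypothesis UP : fine_complete_ultrafilter U.

Lemma ultra_all (y : Pk kappa lambda) (F : O -> set (Pk kappa lambda)) :
  (forall a, val y a -> U (F a)) -> U [set x | forall a, val y a -> F a x].
Proof.
case: UP => UF Uc _ FU; have /andP[yk kNy] : val y #< below kappa.
  by case: (set_mem (valP y)).
have Fy : F @` val y #<= val y by exact: card_image_le.
suff : U (\bigcap_(A in F @` val y) A).
  by apply: filterS => x xF a ya; apply: xF; exists a.
apply: Uc => [_ [a ya <-]|]; first exact: FU.
rewrite /card_lt (card_le_trans Fy yk) /=.
by apply: contra kNy => kF; exact: card_le_trans kF Fy.
Qed.

Lemma prec_ultra (y : Pk kappa lambda) :
  U [set x | prec kappa (val y) (val x)].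
Proof.
case: UP => UF Uc Ufine; have [ysub yk] := set_mem (valP y).
have Uin a : a < kappa -> U [set x | val x a].
  by move=> ak; apply: Ufine; exact: lt_le_trans ak kl.
pose pO : pointedType := HB.pack O (isPointed.Build O kappa).
have injP (A B : set O) :
    A #<= B -> exists2 f : O -> O, set_fun A B f & set_inj A f.
  by move=> /(@pcard_leP _ pO)/injfunPex.
have Usub : U [set x | val y `<=` val x].
  apply: (ultra_all (F := fun a => [set x | val x a])) => a ya.
  by apply: Ufine; exact: ysub.
case/andP: yk => /injP[j jfun jinj] kNy.
have Ule : U [set x | val y #<= (below kappa `&` val x)].
  have : U [set x | forall a, val y a -> val x (j a)].
    by apply: ultra_all => a ya; apply: Uin; exact: jfun.
  apply: filterS => x xj; apply/(@pcard_leP _ pO)/injfunPex.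
  by exists j => // a ya; split; [exact: jfun | exact: xj].
have Unle : U [set x | ~~ ((below kappa `&` val x) #<= val y)].
  case: (@in_ultra_setVsetC _ U
    [set x | (below kappa `&` val x) #<= val y] UF) => [W|]; last first.
    by apply: filterS => x /negP.
  exfalso.
  have /choice[g gP] (x : Pk kappa lambda) : exists g : O -> O,
      (below kappa `&` val x) #<= val y ->
      set_fun (below kappa `&` val x) (val y) g /\
      set_inj (below kappa `&` val x) g.
    have [/injP[f ? ?]|] := boolP ((below kappa `&` val x) #<= val y).
      by exists f.
    by exists id.
  have hex a : exists i, a < kappa ->
      val y i /\ U [set x | [/\ (below kappa `&` val x) #<= val y,
                               val x a & g x a = i]].
    apply: contrapT => /forallNP hN.
    have ak : a < kappa by apply: contrapT => ?; apply: (hN kappa).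
    have : U [set x | forall i, val y i -> g x a <> i].
      apply: ultra_all => i yi.
      case: (@in_ultra_setVsetC _ U [set x | g x a = i] UF) => // Ugi.
      exfalso; apply: (hN i) => _; split=> //.
      by apply: filterS3 W (Uin a ak) Ugi => x.
    move=> /(filterI (filterI W (Uin a ak)))/filter_ex[x [[Wx xa] gx]].
    by case: (gP x Wx) => gfun _; apply: (gx (g x a)) => //; exact: gfun.
  case/choice: hex => h hP; move/negP: kNy; apply.
  apply/(@pcard_leP _ pO)/injfunPex.
  exists h => [a /hP[]//|a b /set_mem ak /set_mem bk hab].
  have [_ Ua] := hP _ ak; have [_ Ub] := hP _ bk.
  have [x [[Wx xa ga] [_ xb gb]]] := filter_ex (filterI Ua Ub).
  case: (gP x Wx) => _; apply; rewrite ?inE //.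
  by rewrite ga gb.
apply: filterS3 Usub Ule Unle => x ? le nle; split=> //.
by rewrite /card_lt le nle.
Qed.

Lemma prikry_one_subproof : [set t | increasing t] \in prikry_cond.
Proof.
rewrite inE; split.
  split=> // s t /= tinc /prefixP[u tE]; move: tinc.
  by rewrite /increasing tE => /cat_sorted2[].
exists [::]; split=> //= [t _|t tinc _]; first by rewrite prefix0s.
case: UP => UF _ _.
case/lastP: t tinc => [|t y] tinc.
  by apply: filterS filterT => x _.
apply: filterS (prec_ultra y) => x yx.
move: tinc; rewrite /increasing; case: t => [|z t] /=.
  by move=> _; rewrite andbT; exact/asboolP.
by rewrite !rcons_path last_rcons => ->; exact/asboolP.
Qed.

(** The weakest condition is the tree of all finite increasing sequences; that
    it is a condition uses fineness and completeness of [U]. *)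
Definition prikry : forcing :=
  @Forcing prikry_cond (fun T S : prikry_cond => val T `<=` val S)
    (exist _ [set t | increasing t] prikry_one_subproof)
    (fun T : prikry_cond => @subset_refl _ (val T))
    (fun S T V : prikry_cond => @subset_trans _ (val S) (val T) (val V))
    (fun T : prikry_cond => proj1 (proj1 (set_mem (valP T)))).

End Prikry.

(* Main.v *)
From HB Require Import structures.
Require Import Defs.
From mathcomp Require Import all_boot all_order.
From mathcomp Require Import boolp classical_sets functions cardinality filter.
From Stdlib Require Import Relation_Operators Wellfounded.

(** Let P be the separative quotient of Q.  Predistributivity arranges fewer than
    kappa dense open sets in countably many levels, such that, below some
    condition, one dense set is contained in all the members of a level.  Prikry
    trees do the same: by the strong Prikry property, a dense open set of trees is
    entered, below a direct extension, after a fixed finite number of steps.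

    From a projection pi to predistributivity ([projects_predistributive]).  Pulled
    back along pi, each of the given dense open sets is entered after finitely many
    steps below a direct extension ([strong_prikry]).  Fewer than kappa direct
    extensions have a common one, say W, and the conditions lying in pi(S), for some
    tree S contained in W whose nodes are compatible with a node of W that is n
    steps above the stem, form the n-th dense set.

    From predistributivity to a projection ([predistributive_projects]).  It is
    enough to attach to each finite sequence s of points of P_kappa(lambda) a
    condition p_s, decreasing along end-extension and arbitrary at length one, such
    that every tree has a node t with p_t in any given dense open set
    ([evaluation_projects]); a tree T is then sent to the regular open set of all p
    below which the p_t, for t in T, are dense.

    Let V be a fine ultrafilter over P_kappa(2^lambda), seen as a measure on small
    families of subsets of P.  Predistributivity below p gives, for each such
    family, a level function into the natural numbers; its limit along V is a level
    function h_p on all dense open sets, a [grading].  For almost every family y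
    there is f(y) below p which lies in the members of y of level at most m and
    below which the members of y of any given level have dense intersection.  The
    difficulty is that the level function h_(f(y)) used at the next step has nothing
    to do with h_p, and that the step cannot remember y, as there may be more
    families than finite sequences of points of P_kappa(lambda).  The remedy is to apply
    predistributivity to the intersections of subfamilies as well: then h_q is
    bounded on every sequence of sets whose intersection is dense below q.
    Consequently the level after a step is bounded, almost everywhere, by a function
    of the level before ([grading_descent]), and these functions depend only
    on the condition reached and on the levels asked for.  Composing them along s and asking at the k-th step for
    enough levels to cover the initial levels up to k, every dense open set is
    eventually met ([descent_generic]).

    Finally the map f(y) is used at few conditions only for given y, hence can be
    coded by an element of P_kappa(lambda) containing any prescribed one
    ([cofinal_coding]); the image of V under the coding is the required fine
    ultrafilter over P_kappa(lambda). *)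

Set Implicit Arguments.
Unset Strict Implicit.
Unset Printing Implicit Defensive.

Import Order.TTheory.

Local Open Scope classical_set_scope.
Local Open Scope card_scope.
Local Open Scope order_scope.

(** * Well-founded recursion and cardinals *)

Lemma inj_card_leP T U (A : set T) (B : set U) (f : T -> U) :
  (forall x, A x -> B (f x)) ->
  (forall x y, A x -> A y -> f x = f y -> x = y) -> A #<= B.
Proof.
move=> fAB finj.
have [g] : $|{injfun A >-> B}|.
  apply/injfunPex; exists f => //.
  by move=> x y /set_mem Ax /set_mem Ay; exact: finj.
exact: inj_card_le g.
Qed.

Lemma card_le_injP T U (A : set T) (B : set U) (u0 : U) :
  A #<= B -> exists f : T -> U, (forall x, A x -> B (f x)) /\
    forall x y, A x -> A y -> f x = f y -> x = y.
Proof.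
pose pU : pointedType := HB.pack U (gen_choiceMixin U) (gen_eqMixin U) (isPointed.Build U u0).
move=> /(@pcard_leP _ pU)/injfunPex[f fAB finj]; exists f; split=> // x y Ax Ay.
by apply: finj; exact: mem_set.
Qed.

Lemma wf_recursion X T (R : X -> X -> Prop) (wfR : well_founded R)
    (F : set T -> T) :
  exists f : X -> T, forall x, f x = F (f @` [set y | R y x]).
Proof.
pose G x (rec : forall y, R y x -> T) : T :=
  F [set t | exists y (yx : R y x), t = rec y yx].
exists (Fix wfR (fun=> T) G) => x; rewrite Fix_eq; last first.
  move=> z f g fg; congr F; apply/seteqP.
  by split=> t [y [yz ->]]; exists y, yz; rewrite fg.
congr F; apply/seteqP; split=> t /=.
  by move=> [y [yx ->]]; exists y.
by move=> [y yx <-]; exists y, yx.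
Qed.

(** Greedy choice along a well-order: as long as [A] is not exhausted, one
    more point of it can be assigned to the next index. *)
Lemma wf_injection X T (R : X -> X -> Prop) (A : set T) (B : set X) :
  well_founded R -> (forall x y, R x y \/ x = y \/ R y x) ->
  (forall x y, R y x -> B x -> B y) ->
  (forall x, B x -> ~ (A #<= [set y | R y x])) -> B #<= A.
Proof.
move=> wfR totR downB nA.
have [->|/set0P[b Bb]] := eqVneq B set0; first exact: card_ge0.
have [A0|/set0P[t0 At0]] := eqVneq A set0.
  by case: (nA b Bb); rewrite A0; exact: card_ge0.
have /choice[next nextP] (S : set T) : exists t, ~ (A `<=` S) -> A t /\ ~ S t.
  have [AS|/existsNP[t /not_implyP[At nS]]] := pselect (A `<=` S).
    by exists t0.
  by exists t.
have [f fE] := wf_recursion wfR next.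
have fP x : B x -> A (f x) /\ ~ (f @` [set y | R y x]) (f x).
  move=> Bx; rewrite fE; apply: nextP => Af; apply: (nA x Bx).
  exact: card_le_trans (subset_card_le Af) (card_image_le _ _).
apply: (@inj_card_leP _ _ _ _ f) => [x /fP[]//|x y /fP[_ nx] /fP[_ ny] fxy].
case: (totR x y) => [xy|[//|yx]].
  by case: ny; exists x.
by case: nx; exists y.
Qed.

Lemma card_le_setX T T' U U' (A : set T) (A' : set T') (B : set U) (B' : set U') :
  A #<= B -> A' #<= B' -> A `*` A' #<= B `*` B'.
Proof.
have [->|/set0P[b _]] := eqVneq B set0.
  by rewrite card_le0 => /eqP->; rewrite set0X card_ge0.
have [->|/set0P[b' _]] := eqVneq B' set0.
  by rewrite card_le0 => _ /eqP->; rewrite setX0 card_ge0.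
move=> /(card_le_injP b)[f [fAB finj]] /(card_le_injP b')[g [gAB ginj]].
apply: (@inj_card_leP _ _ _ _ (fun x => (f x.1, g x.2))).
  by move=> [x y] [Ax Ay]; split; [exact: fAB | exact: gAB].
move=> [x y] [x' y'] /= [Ax Ay] [Ax' Ay'] [fxx gyy].
by rewrite (finj x x' Ax Ax' fxx) (ginj y y' Ay Ay' gyy).
Qed.

Lemma infinite_setU1_le T (A : set T) (x : T) : infinite_set A -> x |` A #<= A.
Proof.
move=> /infiniteP/(card_le_injP x)[f [fA finj]].
have /choice[g gP] y : exists z, (y = x -> z = f 0%N) /\
    (y <> x -> (forall n, y = f n -> z = f n.+1) /\
               ((forall n, y <> f n) -> z = y)).
  have [->|yx] := pselect (y = x); first by exists (f 0%N).
  have [[n yn]|nf] := pselect (exists n, y = f n).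
    exists (f n.+1); split=> // _; split=> [k|/(_ n)//].
    by rewrite yn => /finj->.
  exists y; split=> // _; split=> // k yk.
  by case: nf; exists k.
pose cases y := (y = x /\ g y = f 0%N) \/
  (y <> x /\ exists n, y = f n /\ g y = f n.+1) \/
  (y <> x /\ (forall n, y <> f n) /\ g y = y).
have gE y : cases y.
  have [g1 g2] := gP y; have [yx|yx] := pselect (y = x); first by left; auto.
  have [h1 h2] := g2 yx; right.
  have [[n yn]|nf] := pselect (exists n, y = f n).
    by left; split=> //; exists n; auto.
  have nf' n : y <> f n by move=> yn; apply: nf; exists n.
  by right; auto.
have fi n m : f n = f m -> n = m by exact: finj.
apply: (@inj_card_leP _ _ _ _ g) => [y xAy|y z xAy xAz].
  by case: (gE y) => [[_ ->]|[[_ [n [_ ->]]]|[yx [_ ->]]]];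
    [exact: fA|exact: fA|case: xAy].
case: (gE y) => [[yx ->]|[[yx [n [yn ->]]]|[yx [ny ->]]]];
case: (gE z) => [[zx ->]|[[zx [k [zk ->]]]|[zx [nz ->]]]] //.
- by rewrite yx zx.
- by move=> /fi.
- by move=> /esym /nz.
- by move=> /fi.
- by move=> /fi[nk]; rewrite yn zk nk.
- by move=> /esym /nz.
- by move=> /ny.
- by move=> /ny.
Qed.

Section Cardinals.
Context {d : Order.disp_t} {O : orderType d}.
Hypothesis wfO : well_founded (fun a b : O => a < b).
Implicit Types (a b c kappa : O).

(** Hessenberg's theorem, by Goedel's pairing: pairs are well-ordered by their
    maximum first, so that the predecessors of a pair lie in the square of a
    smaller ordinal. *)
Lemma infinite_square c :
  infinite_set (below c) -> below c `*` below c #<= below c.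
Proof.
elim/(well_founded_ind wfO): c => c IH infc.
have [[c' [c'c cc']]|cardc] := pselect (exists c', c' < c /\ below c #<= below c').
  have infc' : infinite_set (below c').
    by move=> /(card_le_finite cc'); exact: infc.
  apply: card_le_trans (card_le_setX cc' cc') _.
  apply: card_le_trans (IH c' c'c infc') (subset_card_le _) => b /= bc'.
  exact: lt_trans bc' c'c.
pose key (p : O * O) := (Order.max p.1 p.2, p).
pose lt2 (p q : O * O) := slexprod O O (fun a b => a < b) (fun a b => a < b) p q.
pose R p q := slexprod O (O * O) (fun a b => a < b) lt2 (key p) (key q).
have wfR : well_founded R.
  have wf2 : well_founded lt2 by exact: (wf_slexprod _ _ _ _ wfO wfO).
  exact: (wf_inverse_image _ _ _ key (wf_slexprod _ _ _ _ wfO wf2)).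
have RE p q : R p q -> Order.max p.1 p.2 <= Order.max q.1 q.2.
  move=> H; inversion H; first exact: ltW.
  by rewrite le_eqVlt; apply/orP; left; apply/eqP.
have tot2 p q : lt2 p q \/ p = q \/ lt2 q p.
  move: p q => [p1 p2] [q1 q2].
  have [?|?|->] := ltgtP p1 q1; [by left; left|by right; right; left|].
  have [?|?|->] := ltgtP p2 q2; [by left; right|by right; right; right|].
  by right; left.
have totR p q : R p q \/ p = q \/ R q p.
  have [?|?|E] := ltgtP (Order.max p.1 p.2) (Order.max q.1 q.2);
    [by left; left|by right; right; left|].
  rewrite /R /key E; have [|[|]] := tot2 p q; [by left; right|by right; left|].
  by right; right; right.
apply: (wf_injection wfR totR) => [p q /RE qp [p1 p2]|[p1 p2] [/= p1c p2c]].
  have pc : Order.max p.1 p.2 < c by rewrite gt_max p1 p2.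
  by move: (le_lt_trans qp pc); rewrite gt_max => /andP[].
set m := Order.max p1 p2; have mc : m < c by rewrite gt_max p1c.
have sub : [set q | R q (p1, p2)] `<=` (m |` below m) `*` (m |` below m).
  move=> [q1 q2] /RE; rewrite /= -/m ge_max => /andP[].
  rewrite !le_eqVlt => q1m q2m.
  by split=> /=; [case/predU1P: q1m|case/predU1P: q2m]; [left|right|left|right].
move=> /card_le_trans/(_ (subset_card_le sub)) cM.
have [finm|infm] := pselect (finite_set (below m)).
  by apply: infc; apply: card_le_finite cM _; apply: finite_setX;
    rewrite finite_setU; split=> //; exact: finite_set1.
apply: cardc; exists m; split=> //.
apply: card_le_trans cM (card_le_trans _ (IH m mc infm)).
by apply: card_le_setX; exact: infinite_setU1_le.
Qed.

Lemma card_le_square T U (A : set T) (B : set U) c : infinite_set (below c) ->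
  A #<= below c -> B #<= below c -> A `*` B #<= below c.
Proof.
move=> infc Ac Bc.
by apply: card_le_trans (card_le_setX Ac Bc) _; exact: infinite_square.
Qed.

(** Otherwise greedy choice would embed all of [kappa] into [A]. *)
Lemma card_lt_ord T (A : set T) kappa :
  A #< below kappa -> exists2 c, c < kappa & A #<= below c.
Proof.
move=> /andP[_ /negP nkA]; apply: contrapT => nc; apply: nkA.
apply: (wf_injection wfO) => [x y|x y yx xk|x xk xA].
- by have [|?|] := ltgtP x y; auto.
- exact: lt_trans yx xk.
- by apply: nc; exists x.
Qed.

Lemma card_le_lt_trans T U V (A : set T) (B : set U) (C : set V) :
  A #<= B -> B #< C -> A #< C.
Proof.
move=> AB /andP[BC /negP CB]; rewrite /card_lt (card_le_trans AB BC) /=.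
by apply/negP => CA; apply: CB; exact: card_le_trans CA AB.
Qed.

Lemma card_lt_image T U (f : T -> U) (A : set T) kappa :
  A #< below kappa -> f @` A #< below kappa.
Proof. exact/card_le_lt_trans/card_image_le. Qed.

Variable kappa : O.
Hypothesis kappa_card : uncountable_cardinal kappa.

Lemma ord_card_lt T (A : set T) c :
  c < kappa -> A #<= below c -> A #< below kappa.
Proof. by move=> ck Ac; apply: card_le_lt_trans Ac (kappa_card.1 c ck). Qed.

Lemma card_lt_countable T (A : set T) : countable A -> A #< below kappa.
Proof.
move=> Ac; apply: (card_le_lt_trans Ac); case: kappa_card => _ nck.
apply/andP; split; last exact/negP.
apply/infiniteP => fink; apply: nck; exact: finite_set_countable.
Qed.

Lemma card_lt_common T U (A : set T) (B : set U) :
  A #< below kappa -> B #< below kappa ->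
  exists2 c, c < kappa & [/\ infinite_set (below c), A #<= below c & B #<= below c].
Proof.
move=> /card_lt_ord[a ak Aa] /card_lt_ord[b bk Bb].
have /card_lt_ord[w wk Nw] : [set: nat] #< below kappa.
  by apply: card_lt_countable; exact: card_lexx.
exists (Order.max w (Order.max a b)); first by rewrite !gt_max wk ak.
have le x : x <= Order.max w (Order.max a b) ->
    below x #<= below (Order.max w (Order.max a b)).
  by move=> xm; apply: subset_card_le => y /= yx; exact: lt_le_trans yx xm.
split.
- apply/infiniteP; apply: card_le_trans Nw (le _ _).
  by rewrite le_max lexx.
- by apply: card_le_trans Aa (le _ _); rewrite !le_max lexx orbT.
- by apply: card_le_trans Bb (le _ _); rewrite !le_max lexx !orbT.
Qed.

Lemma card_lt_setX T U (A : set T) (B : set U) :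
  A #< below kappa -> B #< below kappa -> A `*` B #< below kappa.
Proof.
move=> Ak Bk; have [c ck [infc Ac Bc]] := card_lt_common Ak Bk.
by apply: ord_card_lt ck _; exact: card_le_square.
Qed.

Lemma card_lt_setU T (A B : set T) :
  A #< below kappa -> B #< below kappa -> A `|` B #< below kappa.
Proof.
move=> Ak Bk; have [c ck [infc Ac Bc]] := card_lt_common Ak Bk.
apply: (ord_card_lt ck).
have [f0 [f0c f0i]] := card_le_injP c ((infiniteP _).1 infc).
have [f [fc fi]] := card_le_injP c Ac; have [g [gc gi]] := card_le_injP c Bc.
apply: card_le_trans (infinite_square infc).
apply: (@inj_card_leP _ _ _ _
  (fun x => if pselect (A x) then (f0 0%N, f x) else (f0 1%N, g x))) => [x|x y].
  case: pselect => [Ax _|nAx [//|Bx]].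
    by split; [exact: f0c | exact: fc].
  by split; [exact: f0c | exact: gc].
case: pselect => [Ax _|nAx [//|Bx]]; case: pselect => [Ay _|nAy [//|By]].
- by move=> [/fi]; apply.
- by move=> [/f0i] => /(_ I I).
- by move=> [/f0i] => /(_ I I).
- by move=> [/gi]; apply.
Qed.

End Cardinals.

(** * Complete ultrafilters *)

Section CompleteUltrafilters.
Context {d : Order.disp_t} {O : orderType d}.
Hypothesis wfO : well_founded (fun a b : O => a < b).
Variable kappa : O.
Hypothesis kappa_card : uncountable_cardinal kappa.
Variables (T : Type) (V : set_system T).
Hypothesis Vultra : UltraFilter V.
Hypothesis Vcomplete : complete kappa V.

Lemma complete_forall I (J : set I) (A : I -> set T) : J #< below kappa ->
  (forall i, J i -> V (A i)) -> V [set x | forall i, J i -> A i x].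
Proof.
move=> Jk VA; have : V (\bigcap_(B in A @` J) B).
  by apply: Vcomplete => [_ [i /VA ? <-]//|]; exact: card_lt_image.
by apply: filterS => x xA i Ji; apply: xA; exists i.
Qed.

Lemma complete_forall_countable I (J : set I) (A : I -> set T) : countable J ->
  (forall i, J i -> V (A i)) -> V [set x | forall i, J i -> A i x].
Proof. by move=> cJ; apply: complete_forall; exact: (card_lt_countable kappa_card). Qed.

(** Otherwise each of the fewer than [kappa] values would be avoided almost
    everywhere. *)
Lemma complete_constant S (C : set S) (g : T -> S) : C #< below kappa ->
  V [set x | C (g x)] -> exists s, V [set x | g x = s].
Proof.
move=> Ck VC; apply: contrapT => ng.
have : V [set x | forall s, C s -> g x <> s].
  apply: complete_forall => // s _.
  have [Vs|//] := in_ultra_setVsetC [set x | g x = s] Vultra.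
  by case: ng; exists s.
by move=> /(filterI VC)/filter_ex[x [Cx /(_ _ Cx)]].
Qed.

Lemma complete_limit_nat I (h : T -> I -> nat) :
  exists k : I -> nat, forall i, V [set x | h x i = k i].
Proof.
have /choice[k kP] i : exists n, V [set x | h x i = n].
  apply: (@complete_constant nat setT); last by apply: filterS filterT.
  by apply: (card_lt_countable kappa_card); exact: card_lexx.
by exists k.
Qed.

(** The map [cov] spreads the ultrafilter over [kappa], as fineness does: it
    yields a function [xi] into [kappa] that is constant on no large set.  If
    [kappa] embedded into the power set of [A], the ultrafilter would decide each
    of the fewer than [kappa] bits of the subset attached to [xi x], making
    [xi] constant on a large set. *)
Lemma complete_strong_limit (cov : T -> set O) :
  (forall x, cov x #< below kappa) ->
  (forall a, a < kappa -> V [set x | cov x a]) ->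
  forall U (A : set U), A #< below kappa -> [set X | X `<=` A] #< below kappa.
Proof.
move=> covk Vcov U A Ak; apply: contrapT => nk.
have kA : below kappa #<= [set X : set U | X `<=` A].
  apply: (wf_injection wfO) => [x y|x y yx xk|x xk xA].
  - by have [|?|] := ltgtP x y; auto.
  - exact: lt_trans yx xk.
  - by apply: nk; exact: (ord_card_lt kappa_card xk).
have [g [gA ginj]] := card_le_injP (set0 : set U) kA.
have /choice[xi xiP] x : exists a, a < kappa /\ ~ cov x a.
  apply: contrapT => nx; have /andP[_ /negP] := covk x; apply.
  apply: subset_card_le => a ak; apply: contrapT => nca.
  by apply: nx; exists a.
have Vne a : a < kappa -> V [set x | xi x <> a].
  by move=> /Vcov; apply: filterS => x cxa xa; apply: (xiP x).2; rewrite xa.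
have : V [set x | forall u, A u -> g (xi x) u <-> V [set y | g (xi y) u]].
  apply: complete_forall => // u _.
  have [Vu|Vu] := in_ultra_setVsetC [set y | g (xi y) u] Vultra.
    by apply: filterS (Vu) => x.
  apply: filterS (Vu) => x gxu; split=> [//|Vu'].
  by have [y []] := filter_ex (filterI Vu Vu').
move=> /[dup] V1 /filter_ex[x gx].
have [y [gy yx]] := filter_ex (filterI V1 (Vne _ (xiP x).1)).
apply: yx; apply: ginj; [exact: (xiP y).1|exact: (xiP x).1|].
apply/seteqP; split=> u gu.
  have Au := gA _ (xiP y).1 _ gu; exact/(gx u Au)/(gy u Au).
have Au := gA _ (xiP x).1 _ gu; exact/(gy u Au)/(gx u Au).
Qed.

Lemma complete_image S (f : T -> S) :
  UltraFilter (fun A => V (f @^-1` A)) /\ complete kappa (fun A => V (f @^-1` A)).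
Proof.
split.
  have FF : ProperFilter (fun A => V (f @^-1` A)).
    split; first by rewrite preimage_set0; exact: filter_not_empty.
    split; first by rewrite preimage_setT; exact: filterT.
      by move=> A B VA VB; apply: filterS (filterI VA VB).
    by move=> A B AB; apply: filterS => x; exact: AB.
  split=> // G GF VG; apply/funext => A; apply/propext; split; last exact: VG.
  move=> GA; have [//|VA] := in_ultra_setVsetC (f @^-1` A) Vultra.
  have GnA : G (~` A) by apply: VG.
  by have [s []] := filter_ex (filterI GA GnA).
move=> F FV Fk; apply: filterS (complete_forall Fk FV) => x xF A FA.
exact: xF.
Qed.

End CompleteUltrafilters.

(** * Coding small families by sets of ordinals *)

Section Covering.
Context {d : Order.disp_t} {O : orderType d}.
Variables (kappa lambda mu : O).
Variables (V : set_system (Pk kappa mu)).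
Hypothesis Vultra : UltraFilter V.
Hypothesis Vfine : fine V.
Hypothesis mu_two_power : is_two_power mu lambda.

(** Subsets of [A] are coded by ordinals below [mu], so that an element of
    [Pk kappa mu] is a small family of subsets of [A]; fineness says that almost
    all of these families contain a given subset. *)
Lemma fine_covering W (A : set W) : A #<= below lambda ->
  exists cov : Pk kappa mu -> set (set W),
    (forall y, cov y #< below kappa) /\
    forall X, X `<=` A -> V [set y | cov y X].
Proof.
move=> /(card_le_injP lambda)[j [jl jinj]].
have [_] := mu_two_power; rewrite card_eq_le.
move=> /andP[_ /(card_le_injP mu)[c [cmu cinj]]].
have jX X : X `<=` A -> j @` X `<=` below lambda.
  by move=> XA _ [w /XA Aw <-]; exact: jl.
exists (fun y => [set X | X `<=` A /\ val y (c (j @` X))]); split=> [y|X XA].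
  have [_ yk] := set_mem (valP y); apply: card_le_lt_trans yk.
  apply: (@inj_card_leP _ _ _ _ (fun X => c (j @` X))) => [X []//|].
  move=> X Y [XA _] [YA _] /cinj E.
  have {}E : j @` X = j @` Y by apply: E; exact: jX.
  apply/seteqP; split=> w.
    move=> Xw; have : (j @` X) (j w) by exists w.
    rewrite E => -[v Yv /jinj vw]; rewrite -vw //; [exact: YA|exact: XA].
  move=> Yw; have : (j @` Y) (j w) by exists w.
  rewrite -E => -[v Xv /jinj vw]; rewrite -vw //; [exact: XA|exact: YA].
apply: filterS (Vfine (cmu _ (jX X XA))).
by move=> y.
Qed.

End Covering.

Section Coding.
Context {d : Order.disp_t} {O : orderType d}.
Hypothesis wfO : well_founded (fun a b : O => a < b).
Variables (kappa lambda : O).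
Hypothesis kappa_card : uncountable_cardinal kappa.
Hypothesis kappa_le_lambda : kappa <= lambda.

Lemma infinite_below : infinite_set (below lambda).
Proof.
have kl : below kappa #<= below lambda.
  by apply: subset_card_le => a /= ak; exact: lt_le_trans ak kappa_le_lambda.
move=> /(card_le_finite kl)/finite_set_countable; exact: kappa_card.2.
Qed.

(** Every small family can be coded by some set above any given one: the
    ordinals below [lambda] are arranged in [kappa] rows, each containing a copy
    of [W] and a marker; a set codes the part of [W] found in the first row
    whose marker it misses.  Since a set of size less than [kappa] is disjoint
    from some row, it can be enlarged to code anything. *)
Lemma cofinal_coding W (w0 : W) : [set: W] #<= below lambda ->
  exists H : set O -> set W, forall (x : set O) (C : set W),
    x `<=` below lambda -> x #< below kappa -> C #< below kappa ->
    exists z, [/\ x `<=` z, z `<=` below lambda, z #< below kappa & H z = C].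
Proof.
move=> Wl; have infl := infinite_below.
have kl : below kappa #<= below lambda.
  by apply: subset_card_le => a /= ak; exact: lt_le_trans ak kappa_le_lambda.
have /(card_le_injP lambda)[e [el einj]] :
    ([set: W] `*` [set: nat]) `*` below kappa #<= below lambda.
  apply: card_le_square => //; apply: card_le_square => //; exact/infiniteP.
have {}el w n c : c < kappa -> e (w, n, c) < lambda by move=> ck; exact: el.
have {}einj w n c w' n' c' : c < kappa -> c' < kappa ->
    e (w, n, c) = e (w', n', c') -> [/\ w = w', n = n' & c = c'].
  move=> ck ck' E.
  by have [-> -> ->] : (w, n, c) = (w', n', c') by exact: einj.
pose mark c := e (w0, 1%N, c); pose point w c := e (w, 0%N, c).
exists (fun z => [set w | exists c, [/\ c < kappa, ~ z (mark c),
  (forall b, b < c -> z (mark b)) & z (point w c)]]) => x C xl xk Ck.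
have [c ck xc] : exists2 c, c < kappa & forall w n, ~ x (e (w, n, c)).
  apply: contrapT => nc; have /andP[_ /negP] := xk; apply.
  have /choice[g gP] c : exists a, c < kappa -> x a /\ exists w n, a = e (w, n, c).
    have [ck|nck] := pselect (c < kappa); last by exists c.
    apply: contrapT => /forallNP na; apply: nc; exists c => // w n xe.
    by apply: (na (e (w, n, c))) => _; split=> //; exists w, n.
  apply: (@inj_card_leP _ _ _ _ g) => [c /gP[]//|b c bk ck].
  have [_ [w [n ->]]] := gP b bk; have [_ [w' [n' ->]]] := gP c ck.
  by move=> /(einj _ _ _ _ _ _ bk ck)[].
exists (x `|` mark @` below c `|` (point^~ c) @` C); split.
- by move=> a xa; left; left.
- move=> a [[/xl//|[b bc <-]]|[w _ <-]]; apply: el => //.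
  exact: lt_trans bc ck.
- apply: card_lt_setU => //; last exact: card_lt_image.
  by apply: card_lt_setU => //; apply: card_lt_image; exact: kappa_card.1.
set z := _ `|` _.
have zmark b : b < kappa -> z (mark b) -> x (mark b) \/ b < c.
  move=> bk [[|[b' b'c]]|[w _]]; first by left.
    have b'k : b' < kappa by exact: lt_trans b'c ck.
    by move=> /(einj _ _ _ _ _ _ b'k bk)[_ _ <-]; right.
  by move=> /(einj _ _ _ _ _ _ ck bk)[].
have zc : ~ z (mark c) by move=> /(zmark c ck)[/xc//|]; rewrite ltxx.
apply/seteqP; split=> [w [b [bk nb ltb]]|w Cw].
  have -> : b = c.
    have [bc|cb|//] := ltgtP b c; first by case: nb; left; right; exists b.
    by case: (zc (ltb c cb)).
  case=> [[/xc//|[b' b'c]]|[v Cv]].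
    have b'k : b' < kappa by exact: lt_trans b'c ck.
    by move=> /(einj _ _ _ _ _ _ b'k ck)[].
  by move=> /(einj _ _ _ _ _ _ ck ck)[<-].
exists c; split=> // [b bc|]; first by left; right; exists b.
by right; exists w.
Qed.

End Coding.

(** * Gradings of the dense open sets *)

Section Gradings.
Context {d : Order.disp_t} {O : orderType d}.
Hypothesis wfO : well_founded (fun a b : O => a < b).
Variable kappa : O.
Hypothesis kappa_card : uncountable_cardinal kappa.
Variable P : forcing.
Implicit Types (p q r : P) (A D : set P) (Z : set (set P)) (h : set P -> nat).

Definition dense_below p A : Prop :=
  forall r, fle r p -> exists2 s, A s & fle s r.

Lemma dense_below_le p q A : fle q p -> dense_below p A -> dense_below q A.
Proof. by move=> qp pA r rq; apply: pA; exact: fle_trans rq qp. Qed.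

Lemma dense_belowS p A B : A `<=` B -> dense_below p A -> dense_below p B.
Proof. by move=> AB pA r /pA[s /AB Bs sr]; exists s. Qed.

Local Notation dense_open := (dense_open_in [set: P]).

(** The dense open set generated by an open set: it agrees with [A] below every
    condition below which [A] is dense. *)
Definition dense_hull A : set P := A `|` [set r | forall s, fle s r -> ~ A s].

Lemma dense_hull_dense_open A :
  (forall p q, A p -> fle q p -> A q) -> dense_open (dense_hull A).
Proof.
move=> Aopen; split=> // [p _|p q [Ap|nA] _ qp].
- have [[q [qp Aq]]|nA] := pselect (exists q, fle q p /\ A q).
    by exists q => //; left.
  exists p; last exact: fle_refl.
  by right=> s sp As; apply: nA; exists s.
- by left; exact: Aopen qp.
- by right=> s sq; apply: nA; exact: fle_trans sq qp.
Qed.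

Lemma predistributive_family : predistributive P kappa -> forall p Z,
  Z #< below kappa -> Z `<=` dense_open ->
  exists q (e : nat -> set P), [/\ fle q p,
    forall n, dense_open_in (cone q) (e n) &
    forall D, Z D -> exists n, e n `<=` D].
Proof.
move=> Ppre p Z Zk ZD; have [c ck /(card_le_injP kappa)[f [fc finj]]] := card_lt_ord wfO Zk.
have /choice[D DP] a : exists D, dense_open D /\ forall E, Z E -> f E = a -> D = E.
  have [[E [ZE Ea]]|nE] := pselect (exists E, Z E /\ f E = a).
    by exists E; split=> [|E' ZE' E'a]; [exact: ZD|apply: finj => //; rewrite Ea].
  exists setT; split=> [|E ZE Ea]; last by case: nE; exists E.
  by split=> // q _; exists q => //; exact: fle_refl.
have [|q [e [qp eD eZ]]] := Ppre p c D ck; first by move=> a _; exact: (DP a).1.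
exists q, e; split=> // E ZE; have [n enD] := eZ _ (fc E ZE).
by exists n; rewrite -((DP (f E)).2 E ZE erefl).
Qed.

Definition common Z h n : set P := [set r | forall D, Z D -> (h D <= n)%N -> D r].

(** The first clause says that the members of a small family that lie in a given
    level are met simultaneously, densely below some [q] independent of the level;
    the second, that a sequence met simultaneously densely below [p] runs through
    finitely many levels. *)
Definition grading p h : Prop :=
  (forall Z, Z #< below kappa -> Z `<=` dense_open ->
     exists2 q, fle q p & forall n, dense_below q (common Z h n)) /\
  (forall D : nat -> set P, (forall i, dense_open (D i)) ->
     dense_below p [set r | forall i, D i r] ->
     exists n, forall i, (h (D i) <= n)%N).

(** Predistributivity is applied not only to the members of [Z] but also to the
    intersections of all subfamilies: a subfamily whose intersection is dense
    contains a single [e n], hence gets bounded levels. *)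
Lemma predistributive_small_grading : predistributive P kappa ->
  forall p Z, [set Y | Y `<=` Z] #< below kappa -> Z `<=` dense_open ->
  exists q h, [/\ fle q p, forall n, dense_below q (common Z h n) &
    forall Y, Y `<=` Z -> dense_below p (\bigcap_(D in Y) D) ->
      exists n, forall D, Y D -> (h D <= n)%N].
Proof.
move=> Ppre p Z Zk ZD.
pose hull (Y : set (set P)) := dense_hull (\bigcap_(D in Y) D).
have [|E|q [e [qp eD eZ]]] :=
    predistributive_family Ppre p (Z := hull @` [set Y | Y `<=` Z]).
- exact: card_lt_image.
- move=> [Y YZ <-]; apply: dense_hull_dense_open => r s Yr sr D YD.
  by have [_ _ Do] := ZD D (YZ D YD); apply: Do sr => //; exact: Yr.
have eY Y : Y `<=` Z -> dense_below p (\bigcap_(D in Y) D) ->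
    exists n, forall D, Y D -> e n `<=` D.
  move=> YZ pY; have [|n en] := eZ (hull Y); first by exists Y.
  exists n => D YD r er; have [eq _ _] := eD n.
  have rp : fle r p by apply: fle_trans qp; exact: eq.
  case: (en r er) => [/(_ D YD)//|nY].
  by have [s Ys sr] := pY r rp; case: (nY s sr).
(* Taking the least index makes [h] bounded by [n] on all the [D] that contain
   [e n], which is what the last clause needs. *)
have /choice[h hP] D : exists n, Z D -> e n `<=` D /\ forall m, e m `<=` D -> (n <= m)%N.
  have [ZDD|nZ] := pselect (Z D); last by exists 0%N.
  have ex : exists n, `[< e n `<=` D >].
    have [E ->||n en] := eY [set D]; [by []| |by exists n; apply/asboolP; exact: en].
    rewrite bigcap_set1 => r _; have [_ Dd _] := ZD D ZDD; exact: Dd.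
  exists (ex_minn ex) => _; case: ex_minnP => n /asboolP en nmin.
  by split=> // m em; apply: nmin; exact/asboolP.
exists q, h; split=> // [n|Y YZ pY].
  apply: (@dense_belowS _ [set r | forall i, (i <= n)%N -> e i r]).
    by move=> r er D ZDD hn; have [hD _] := hP D ZDD; apply: hD; exact: er.
  elim: n => [|n IH] r rq.
    have [_ e0 _] := eD 0%N; have [s e0s sr] := e0 r rq.
    by exists s => // i; rewrite leqn0 => /eqP->.
  have [s es sr] := IH r rq; have sq := fle_trans sr rq.
  have [_ en _] := eD n.+1; have [t ent ts] := en s sq.
  exists t; last exact: fle_trans ts sr.
  move=> i; rewrite leq_eqVlt => /predU1P[->//|]; rewrite ltnS => /es eis.
  by have [_ _ eo] := eD i; apply: (eo _ _ eis _ ts); exact: fle_trans ts sq.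
have [n en] := eY Y YZ pY; exists n => D YD.
by have [_] := hP D (YZ D YD); apply; exact: en.
Qed.

Variables (T : Type) (V : set_system T).
Hypothesis Vultra : UltraFilter V.
Hypothesis Vcomplete : complete kappa V.
Variable cov : T -> set (set P).
Hypothesis cov_small : forall y, cov y #< below kappa.
Hypothesis Vcov : forall D, V [set y | cov y D].
Hypothesis strong_limit : forall U (A : set U),
  A #< below kappa -> [set X | X `<=` A] #< below kappa.

Let fam y := cov y `&` dense_open.

Let fam_small y : fam y #< below kappa.
Proof. exact: card_le_lt_trans (subset_card_le (@subIsetl _ _ _)) (cov_small y). Qed.

(** Levels are taken almost everywhere with respect to [V]: a small family, or a
    sequence, then has the same levels with respect to almost every [y]. *)
Lemma predistributive_grading :
  predistributive P kappa -> forall p, exists h, grading p h.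
Proof.
move=> Ppre p.
have /choice[qh qhP] y : exists qh : P * (set P -> nat),
    [/\ fle qh.1 p, forall n, dense_below qh.1 (common (fam y) qh.2 n) &
    forall Y, Y `<=` fam y -> dense_below p (\bigcap_(D in Y) D) ->
      exists n, forall D, Y D -> (qh.2 D <= n)%N].
  have [||q [h qhP]] := predistributive_small_grading Ppre p (Z := fam y).
  - exact: strong_limit (fam_small y).
  - by move=> D [].
  by exists (q, h).
have [h hP] := complete_limit_nat kappa_card Vultra Vcomplete (fun y => (qh y).2).
have Vh D : dense_open D -> V [set y | fam y D /\ (qh y).2 D = h D].
  by move=> Dd; apply: filterS (filterI (Vcov D) (hP D)) => y [].
exists h; split=> [Z Zk ZD|D Dd pD].
  have : V [set y | forall D, Z D -> fam y D /\ (qh y).2 D = h D].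
    by apply: (complete_forall Vultra Vcomplete Zk) => D /ZD; exact: Vh.
  move=> /filter_ex[y yZ]; have [qp qd _] := qhP y; exists (qh y).1 => // n.
  apply: dense_belowS (qd n) => r rc D ZDD hn.
  by have [fD hD] := yZ D ZDD; apply: rc => //; rewrite hD.
have : V [set y | forall i, setT i -> fam y (D i) /\ (qh y).2 (D i) = h (D i)].
  apply: (complete_forall_countable kappa_card Vultra Vcomplete); first exact: card_lexx.
  by move=> i _; exact: Vh.
move=> /filter_ex[y yD]; have [_ _ qb] := qhP y.
have [_ [i _ <-]||n nP] := qb (range D); first by have [] := yD i I.
  by apply: dense_belowS pD => r rD _ [i _ <-]; exact: rD.
exists n => i; have [_ <-] := yD i I; apply: nP; by exists i.
Qed.

(** One descent step.  Along almost all choices [f y] the level of a dense set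
    may grow, but in a way bounded by a function [g] of its old level: a sequence
    of sets from one level whose new levels are unbounded would have, by the
    first clause of [grading], an intersection dense below some [f y],
    contradicting the second clause there. *)
Lemma grading_descent (h : P -> set P -> nat) : (forall p, grading p (h p)) ->
  forall p m, exists (f : T -> P) (g : nat -> nat), [/\ forall y, fle (f y) p,
    forall n, (n <= g n)%N,
    forall D, dense_open D -> (h p D <= m)%N -> V [set y | D (f y)] &
    forall D n, dense_open D -> (h p D <= n)%N ->
      V [set y | (h (f y) D <= g n)%N]].
Proof.
move=> hgr p m.
have /choice[f fP] y : exists r, [/\ fle r p,
    forall D, fam y D -> (h p D <= m)%N -> D r &
    forall n, dense_below r (common (fam y) (h p) n)].
  have [|q qp qd] := (hgr p).1 _ (fam_small y); first by move=> D [].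
  have [r rc rq] := qd m q (fle_refl q).
  exists r; split=> // [|n]; first exact: fle_trans rq qp.
  exact: dense_below_le rq (qd n).
have Vfam D : dense_open D -> V [set y | fam y D].
  by move=> Dd; apply: filterS (Vcov D) => y.
have [k kP] := complete_limit_nat kappa_card Vultra Vcomplete (fun y => h (f y)).
have /choice[g gP] n : exists b, forall D, dense_open D -> (h p D <= n)%N ->
    (k D <= b)%N.
  apply: contrapT => /forallNP nb.
  have /choice[D DP] b : exists D, [/\ dense_open D, (h p D <= n)%N & (b < k D)%N].
    have /existsNP[D /not_implyP[Dd /not_implyP[Dn /negP]]] := nb b.
    by rewrite -ltnNge; exists D.
  have : V [set y | forall i, setT i -> fam y (D i) /\ h (f y) (D i) = k (D i)].
    apply: (complete_forall_countable kappa_card Vultra Vcomplete).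
      exact: card_lexx.
    by move=> i _; have [Di _ _] := DP i; exact: filterI (Vfam _ Di) (kP _).
  move=> /filter_ex[y yD]; have [_ _ /(_ n) fd] := fP y.
  have [||N NP] := (hgr (f y)).2 D.
  - by move=> i; have [] := DP i.
  - apply: dense_belowS fd => r rc i.
    by have [_ Din _] := DP i; apply: rc => //; have [] := yD i I.
  have [_ hk] := yD N I; have [_ _] := DP N.
  by rewrite -hk ltnNge NP.
exists f, (fun n => maxn n (g n)); split=> [y|n|D Dd Dm|D n Dd Dn].
- by have [] := fP y.
- exact: leq_maxl.
- by apply: filterS (Vfam D Dd) => y fD; have [_ fm _] := fP y; exact: fm.
- apply: filterS (kP D) => y /= ->.
  by rewrite leq_max (gP n D Dd Dn) orbT.
Qed.

End Gradings.

(** * From gradings to a projection *)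

Lemma prefix_total (X : eqType) (s t v : seq X) : prefix s v -> prefix t v -> prefix s t || prefix t s.
Proof.
move=> /prefixP[a ->]; elim: s t => [|x s IH] [|y t] //=; rewrite ?prefix0s //.
by case: eqVneq => //= _; exact: IH.
Qed.

Section Evaluation.
Variables (P : forcing) (X : eqType).
Variables (start : X -> P) (w : X -> P -> nat -> P) (g : P -> nat -> nat -> nat).
Hypothesis w_le : forall x p m, fle (w x p m) p.

(** The state reached along a sequence: a condition, a bound for the current
    level of the sets of each initial level, and the number of steps made.  The
    next step asks for all initial levels up to the number of steps made. *)
Record state := State { st_cond : P; st_bound : nat -> nat; st_step : nat }.

Definition st_level (st : state) : nat :=
  \max_(i < (st_step st).+1) st_bound st i.

Definition st_next (st : state) (x : X) : state :=
  State (w x (st_cond st) (st_level st))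
        (g (st_cond st) (st_level st) \o st_bound st) (st_step st).+1.

Definition st_run (x : X) (s : seq X) : state :=
  foldl st_next (State (start x) id 0) s.

Definition eval (s : seq X) : P :=
  if s is x :: s' then st_cond (st_run x s') else fone.

Lemma st_run_rcons x s y : st_run x (rcons s y) = st_next (st_run x s) y.
Proof. by rewrite /st_run foldl_rcons. Qed.

Lemma eval_prefix s t : prefix s t -> fle (eval t) (eval s).
Proof.
move=> /prefixP[u ->{t}]; elim/last_ind: u => [|u y IH].
  by rewrite cats0; exact: fle_refl.
rewrite -rcons_cat; apply: fle_trans IH.
case: (s ++ u) => [|x v]; first exact: fle_one.
by rewrite rcons_cons /= st_run_rcons; exact: w_le.
Qed.

Lemma st_level_ge st n : (n <= st_step st)%N -> (st_bound st n <= st_level st)%N.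
Proof. by rewrite -ltnS => nk; exact: (leq_bigmax (Ordinal nk)). Qed.

End Evaluation.

Section PrikryTrees.
Context {d : Order.disp_t} {O : orderType d}.
Variables (kappa lambda : O) (U : set_system (Pk kappa lambda)).
Hypothesis kl : kappa <= lambda.
Hypothesis UP : fine_complete_ultrafilter U.
Local Notation PU := (prikry kl UP).
Implicit Types (s t : seq (Pk kappa lambda)) (T : PU).

Lemma prikry_treeP T : is_tree (val T).
Proof. by case: (set_mem (valP T)). Qed.

Lemma prikry_stemP T : exists s, is_stem U (val T) s.
Proof. by case: (set_mem (valP T)). Qed.

Lemma prikry_condP (S : set (seq (Pk kappa lambda))) s :
  is_tree S -> is_stem U S s -> exists T : PU, val T = S.
Proof.
move=> St Ss; have Sc : S \in prikry_cond U by rewrite inE; split=> //; exists s.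
by exists (exist _ S Sc).
Qed.

(** The part of a tree compatible with one of its nodes above the stem has
    that node as a stem. *)
Lemma prikry_restrict T s t : is_stem U (val T) s -> val T t -> prefix s t ->
  exists T' : PU, val T' = [set u | val T u /\ (prefix t u || prefix u t)] /\
    is_stem U (val T') t.
Proof.
move=> [_ _ Ts] Tt st; have [UF _ _] := UP; have [Tinc Tdown] := prikry_treeP T.
pose S := [set u | val T u /\ (prefix t u || prefix u t)].
have Sstem : is_stem U S t.
  split=> [||u [Tu _] tu]; first by split=> //; rewrite prefix_refl.
    by move=> u [].
  apply: filterS (Ts u Tu (prefix_trans st tu)) => x Tux; split=> //.
  by rewrite (prefix_trans tu (prefix_rcons _ _)).
have [|T' T'E] := @prikry_condP S t _ Sstem; last by exists T'; rewrite T'E.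
split=> [u [/Tinc]//|u v [Tv vt] uv]; split; first exact: Tdown uv.
case/orP: vt => [tv|vt]; first exact: prefix_total tv uv.
by rewrite (prefix_trans uv vt) orbT.
Qed.

(** The value of a tree is the set of the conditions below which the evaluations
    of its nodes are dense.  Cutting a tree at a node evaluated inside a given
    regular open set below its value gives an extension with value in that set. *)
Lemma evaluation_projects (P : forcing) (ev : seq (Pk kappa lambda) -> P) :
  (forall s t, prefix s t -> fle (ev t) (ev s)) ->
  (forall p, exists x, ev [:: x] = p) ->
  (forall T D, dense_open_in setT D -> exists2 t, val T t & D (ev t)) ->
  projects PU (RO P).
Proof.
move=> evle evsurj evgen.
pose B T : set P := [set p | dense_below p [set r | exists2 t, val T t & r = ev t]].
have Ble T p q : fle q p -> B T p -> B T q by move=> qp; exact: dense_below_le.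
have BRO T : B T \in @RO_cond P.
  rewrite inE; split.
    apply/seteqP; split=> p pB.
      move=> q /pB[r [rq rB]]; have [s sB sr] := rB r (fle_refl r).
      by exists s => //; exact: fle_trans sr rq.
    by move=> q qp; exists q; split; [exact: fle_refl|exact: Ble pB].
  apply: contrapT => nB.
  (* If the value of [T] were empty, the conditions below which no [ev t] lies
     would form a dense open set avoided by [T]. *)
  pose D : set P := [set r | forall t, val T t -> ~ fle (ev t) r].
  have [|t Tt /(_ t Tt)] := evgen T D; last by apply; exact: fle_refl.
  split=> // [p _|p q Dp _ qp t Tt tq]; last by apply: (Dp t Tt); exact: fle_trans tq qp.
  have [//|Bp] := pselect (exists2 q, D q & fle q p).
  case: nB; exists p => r rp; apply: contrapT => nr; apply: Bp; exists r => //.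
  by move=> t Tt tr; apply: nr; exists (ev t) => //; exists t.
exists (fun T => exist _ (B T) (BRO T) : RO P); split.
- move=> T S ST p pB; apply: dense_belowS pB => r [t St ->].
  by exists t => //; exact: ST.
- apply: val_inj => /=; apply/seteqP; split=> // p _ r _.
  have [x <-] := evsurj r; exists (ev [:: x]); last exact: fle_refl.
  by exists [:: x].
move=> T R RT; have [Rreg [r Rr]] := set_mem (valP R).
have Ropen p q : val R p -> fle q p -> val R q.
  rewrite -{1}Rreg => pR qp; rewrite -Rreg => v vq; apply: pR.
  exact: fle_trans vq qp.
have [_ [t Tt ->] tr] := RT r Rr r (fle_refl r).
have [s [Ts Tcmp Tsplit]] := prikry_stemP T.
(* [T'] consists of the nodes of [T] compatible with [t], so that each of them has
   an extension in common with [t]; it is [T] itself if [t] is below the stem. *)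
have [T' [T'T T'v]] : exists T' : PU, val T' `<=` val T /\
    forall u, val T' u -> exists2 v, fle (ev v) (ev u) & fle (ev v) (ev t).
  case/orP: (Tcmp t Tt) => [st|ts].
    have [T' [T'E _]] := prikry_restrict (And3 Ts Tcmp Tsplit) Tt st.
    exists T'; rewrite T'E; split=> [u []//|u [Tu /orP[tu|ut]]].
      by exists u; [exact: fle_refl|exact: evle].
    by exists t; [exact: evle|exact: fle_refl].
  exists T; split=> // u Tu; case/orP: (Tcmp u Tu) => [su|us].
    by exists u; [exact: fle_refl|apply: evle; exact: prefix_trans ts su].
  by exists s; exact: evle.
exists T' => // v vB; rewrite -Rreg => v' /vB[_ [u /T'v[u' u'u u't] ->] uv'].
exists (ev u'); split; first exact: fle_trans u'u uv'.
by apply: Ropen Rr _; exact: fle_trans u't tr.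
Qed.

Variable P : forcing.
Variables (start : Pk kappa lambda -> P).
Variables (w : Pk kappa lambda -> P -> nat -> P) (g : P -> nat -> nat -> nat).
Variable h : P -> set P -> nat.
Hypothesis w_le : forall x p m, fle (w x p m) p.
Hypothesis start_surj : forall p, exists x, start x = p.
Hypothesis g_ge : forall p m n, (n <= g p m n)%N.
Hypothesis w_meets : forall p m D, dense_open_in setT D ->
  (h p D <= m)%N -> U [set x | D (w x p m)].
Hypothesis w_level : forall p m D n, dense_open_in setT D ->
  (h p D <= n)%N -> U [set x | (h (w x p m) D <= g p m n)%N].

(** Let [n] be the level of [D] at some node above the stem.  Along almost every
    branch the level of [D] stays bounded by the [n]-th bound, and [D] is met at
    the first step from the [n]-th on. *)
Lemma descent_generic (T : PU) (D : set P) : dense_open_in setT D ->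
  exists2 t, val T t & D (eval start w g t).
Proof.
move=> Dd; have [UF _ _] := UP.
have [s [Ts Tcmp Tsplit]] := prikry_stemP T.
have [x [t [Txt sxt]]] : exists x t, val T (x :: t) /\ prefix s (x :: t).
  case: s Ts Tcmp Tsplit => [|x s] Ts Tcmp Tsplit; last first.
    by exists x, s; split=> //; exact: prefix_refl.
  have [x Tx] := filter_ex (Tsplit [::] Ts (prefix_refl _)).
  by exists x, [::].
pose run := st_run start w g.
have [n tn] : exists n, (h (st_cond (run x t)) D <= st_bound (run x t) n)%N.
  exists (h (st_cond (run x t)) D).
  elim/last_ind: t {Txt sxt} (h _ D) => [n //|t y IH n].
  by rewrite /run st_run_rcons; apply: leq_trans (IH n) (g_ge _ _ _).
have [j nj] : exists j, (n <= st_step (run x t) + j)%N.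
  by exists n; exact: leq_addl.
elim: j t nj Txt sxt tn => [|j IH] t nj Txt sxt tn.
  rewrite addn0 in nj; have meets := w_meets Dd (leq_trans tn (st_level_ge nj)).
  have [y [Ty Dy]] := filter_ex (filterI (Tsplit _ Txt sxt) meets).
  by exists (rcons (x :: t) y) => //=; rewrite st_run_rcons.
have [y [Ty hy]] := filter_ex (filterI (Tsplit _ Txt sxt)
  (w_level (st_level (run x t)) Dd tn)).
apply: (IH (rcons t y)) => //.
- by rewrite /run st_run_rcons /= addSnnS.
- by rewrite -rcons_cons (prefix_trans sxt (prefix_rcons _ _)).
- by rewrite /run st_run_rcons.
Qed.

Lemma descent_projects : projects PU (RO P).
Proof.
apply: (@evaluation_projects P (eval start w g)) => [s t|p|T D].
- exact: eval_prefix.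
- by have [x <-] := start_surj p; exists x.
- exact: descent_generic.
Qed.

End PrikryTrees.

Section Projecting.
Context {d : Order.disp_t} {O : orderType d}.
Hypothesis wfO : well_founded (fun a b : O => a < b).
Variables (kappa lambda mu : O).
Hypothesis kappa_card : uncountable_cardinal kappa.
Hypothesis kl : kappa <= lambda.
Hypothesis mu_two_power : is_two_power mu lambda.
Hypothesis kappa_compact : strongly_compact kappa mu.
Variable P : forcing.
Hypothesis P_le_lambda : [set: P] #<= below lambda.

(** The ultrafilter is the image of a fine one over the power set of [lambda]
    under a map whose values code, besides enough ordinals for fineness, the part
    of the descent functions that concerns a small set of conditions. *)
Lemma predistributive_projects : predistributive P kappa ->
  exists (U : set_system (Pk kappa lambda)) (UP : fine_complete_ultrafilter U),
    projects (prikry kl UP) (RO P).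
Proof.
move=> Ppre; have [V [Vultra Vcomplete Vfine]] := kappa_compact.
have infl := infinite_below kappa_card kl.
have [covP [covP_small VcovP]] := fine_covering Vultra Vfine mu_two_power P_le_lambda.
have [covO [covO_small VcovO]] :=
  fine_covering Vultra Vfine mu_two_power (card_lexx (below lambda)).
have single_small W (cov : set (set W)) : cov #< below kappa ->
    [set a | cov [set a]] #< below kappa.
  apply: card_le_lt_trans; apply: (@inj_card_leP _ _ _ _ (@set1 W)) => // a b _ _ ab.
  by have : [set b] a by rewrite -ab.
have strong_limit U (A : set U) :
    A #< below kappa -> [set X | X `<=` A] #< below kappa.
  apply: (complete_strong_limit wfO kappa_card Vultra Vcomplete
    (cov := fun y => [set a | covO y [set a]])) => [y|a ak].
    exact: single_small.
  by apply: VcovO => _ ->; exact: lt_le_trans ak kl.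
have VcovP1 X : V [set y | covP y X] by exact: VcovP.
have /choice[h hP] := predistributive_grading wfO kappa_card Vultra Vcomplete
  covP_small VcovP1 strong_limit Ppre.
have /choice[f /choice[g fgP]] (pm : P * nat) :=
  grading_descent kappa_card Vultra Vcomplete covP_small VcovP1 hP pm.1 pm.2.
have W_le : ([set: P] `*` [set: nat]) `*` [set: P] #<= below lambda.
  apply: card_le_square => //; apply: card_le_square => //; exact/infiniteP.
have {}W_le : [set: P * nat * P] #<= below lambda.
  by apply: card_le_trans W_le; apply: subset_card_le.
have [H HP] := cofinal_coding wfO kappa_card kl (fone, 0%N, fone) W_le.
have /choice[phi phiP] y : exists z : Pk kappa lambda,
    [/\ forall a, a < lambda -> covO y [set a] -> val z a &
    forall p m r, H (val z) (p, m, r) <-> covP y [set p] /\ r = f (p, m) y].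
  have [|||z [xz zl zk Hz]] := HP [set a | a < lambda /\ covO y [set a]]
      [set c | covP y [set c.1.1] /\ c.2 = f c.1 y].
  - by move=> a [].
  - by apply: card_le_lt_trans (single_small _ _ (covO_small y));
      apply: subset_card_le => a [].
  - have : [set p | covP y [set p]] `*` [set: nat] #< below kappa.
      apply: card_lt_setX => //; first exact: single_small.
      by apply: (card_lt_countable kappa_card); exact: card_lexx.
    apply: card_le_lt_trans; apply: (@inj_card_leP _ _ _ _ fst) => [[[p m] r] []//|].
    by move=> [pm r] [pm' r'] [_ /= ->] [_ /= ->] ->.
  have zPk : z \in Pk kappa lambda by rewrite inE.
  exists (exist _ z zPk); split=> [a al ca|p m r /=]; first exact: xz.
  by rewrite Hz.
(* The decoding function is forced to be decreasing on all sets, including those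
   that code nothing sensible. *)
have /choice[w wP] (z : Pk kappa lambda) : exists w : P -> nat -> P, forall p m,
    fle (w p m) p /\
    forall r, fle r p -> H (val z) (p, m, r) -> H (val z) (p, m, w p m).
  have /choice[w wP] (pm : P * nat) : exists s, fle s pm.1 /\
      forall r, fle r pm.1 -> H (val z) (pm, r) -> H (val z) (pm, s).
    have [[s [sp Hs]]|ns] := pselect (exists s, fle s pm.1 /\ H (val z) (pm, s)).
      by exists s; split.
    exists pm.1; split=> [|r rp Hr]; first exact: fle_refl.
    by case: ns; exists r.
  by exists (fun p m => w (p, m)) => p m; exact: (wP (p, m)).
have wphi p m : V [set y | w (phi y) p m = f (p, m) y].
  apply: filterS (VcovP1 [set p]) => y cp.
  have [fp _ _ _] := fgP (p, m); have [_ HE] := phiP y.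
  have Hf : H (val (phi y)) (p, m, f (p, m) y) by apply/HE.
  by have /HE[] := (wP (phi y) p m).2 _ (fp y) Hf.
have [j [jl jinj]] := card_le_injP lambda P_le_lambda.
have /choice[start startP] (x : Pk kappa lambda) :
    exists p, forall q, val x = [set j q] -> p = q.
  have [[q xq]|nq] := pselect (exists q, val x = [set j q]).
    exists q => q'; rewrite xq => E.
    by apply: jinj => //; have : [set j q] (j q) by []; rewrite E.
  by exists fone => q xq; case: nq; exists q.
have [Uultra Ucomplete] := complete_image Vultra Vcomplete phi.
have UP : fine_complete_ultrafilter (fun A => V (phi @^-1` A)).
  split=> // a al; apply: filterS (VcovO [set a] _) => [y ca|_ -> //].
  by have [xz _] := phiP y; exact: xz.
exists (fun A => V (phi @^-1` A)), UP.
apply: (@descent_projects _ _ _ _ _ kl UP P start w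
  (fun p m => g (p, m)) h).
- by move=> x p m; exact: (wP x p m).1.
- move=> p; have xPk : [set j p] \in Pk kappa lambda.
    rewrite inE; split=> [_ -> /=|]; first exact: jl.
    by apply: (card_lt_countable kappa_card); exact: countable1.
  by exists (exist _ [set j p] xPk); exact: startP.
- by move=> p m n; have [_ + _ _] := fgP (p, m); exact.
- move=> p m D Dd Dm; have [_ _ fm _] := fgP (p, m).
  by apply: filterS (filterI (wphi p m) (fm D Dd Dm)) => y [/= ->].
- move=> p m D n Dd Dn; have [_ _ _ fl] := fgP (p, m).
  by apply: filterS (filterI (wphi p m) (fl D n Dd Dn)) => y [/= ->].
Qed.

End Projecting.

(** * The strong Prikry property *)

Lemma prefix_antisym_size (X : eqType) (s t v : seq X) :
  prefix s v -> prefix t v -> size s = size t -> s = t.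
Proof.
by rewrite !prefixE => /eqP sE /eqP tE st; rewrite -[RHS]tE -st sE.
Qed.

Lemma prefix_size_eq (X : eqType) (s t : seq X) :
  prefix s t -> (size t <= size s)%N -> s = t.
Proof.
move=> st ts; apply: (prefix_antisym_size st (prefix_refl t)).
by apply/eqP; rewrite eqn_leq ts size_prefix.
Qed.

Lemma prefix_rconsP (X : eqType) (s t : seq X) x :
  prefix s (rcons t x) -> s = rcons t x \/ prefix s t.
Proof.
move=> stx; case/orP: (prefix_total stx (prefix_rcons t x)) => [|ts]; first by right.
have [xs|] := leqP (size (rcons t x)) (size s); first by left; exact: prefix_size_eq.
by rewrite size_rcons ltnS => /(prefix_size_eq ts) ->; right; exact: prefix_refl.
Qed.

Section StrongPrikry.
Context {d : Order.disp_t} {O : orderType d}.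
Variables (kappa lambda : O) (U : set_system (Pk kappa lambda)).
Hypothesis kappa_card : uncountable_cardinal kappa.
Hypothesis kl : kappa <= lambda.
Hypothesis UP : fine_complete_ultrafilter U.
Local Notation PU := (prikry kl UP).
Implicit Types (s t u v : seq (Pk kappa lambda)) (T R S : PU).

Lemma prikry_long_node T s n : is_stem U (val T) s ->
  exists v, [/\ val T v, prefix s v & (n <= size v)%N].
Proof.
move=> [Ts _ Tsplit]; have [UF _ _] := UP.
elim: n => [|n [v [Tv sv nv]]]; first by exists s; rewrite prefix_refl.
have [x Tx] := filter_ex (Tsplit v Tv sv).
exists (rcons v x); split=> //; last by rewrite size_rcons ltnS.
exact: prefix_trans sv (prefix_rcons _ _).
Qed.

Variable E : set PU.
Hypothesis E_open : forall S T, E T -> val S `<=` val T -> E S.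
Hypothesis E_dense : forall T, exists2 S, E S & val S `<=` val T.

(** The rank counts the steps to be made, along almost all branches above the
    node, before a direct extension enters [E]. *)
Fixpoint good T n t : Prop :=
  if n is n'.+1 then U [set x | val T (rcons t x) /\ good T n' (rcons t x)]
  else exists R, [/\ val R `<=` val T, is_stem U (val R) t & E R].

(** If the stem were not good of any rank, then, [U] being countably complete,
    neither would be the nodes of some subtree with the same stem; this subtree
    would have no extension in [E]. *)
Lemma stem_good T s : is_stem U (val T) s -> exists n, good T n s.
Proof.
move=> [Ts Tcmp Tsplit]; have [UF Uc _] := UP; have [Tinc Tdown] := prikry_treeP T.
apply: contrapT => /forallNP sbad.
pose bad v := forall n, ~ good T n v.
pose S0 := [set u | val T u /\ forall v, prefix s v -> prefix v u -> bad v].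
have S0s : S0 s.
  by split=> // v sv vs; rewrite (prefix_size_eq vs (size_prefix sv)).
have [||S SE] := @prikry_condP _ _ _ _ _ kl UP S0 s.
- split=> [u [/Tinc]//|u v [Tv vbad] uv]; split; first exact: Tdown uv.
  by move=> v' sv' v'u; apply: vbad => //; exact: prefix_trans uv.
- split=> // [u [/Tcmp]//|u [Tu ubad] su].
  have : U [set x | forall n, setT n -> ~ (val T (rcons u x) /\ good T n (rcons u x))].
    apply: (complete_forall_countable kappa_card _ Uc); first exact: card_lexx.
    move=> n _; have [Un|//] := in_ultra_setVsetC
      [set x | val T (rcons u x) /\ good T n (rcons u x)] _.
    by case: (ubad u su (prefix_refl _) n.+1).
  apply: filterS2 (Tsplit u Tu su) => x Tux nx; split=> // v sv.
  move=> /prefix_rconsP[->|vu]; last exact: ubad.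
  by move=> n gn; exact: (nx n I).
have [R ER RS] := E_dense S; have [t Rt] := prikry_stemP R.
(* The stem of [R] is first prolonged beyond [s]. *)
have [v [Rv tv sv]] := prikry_long_node (size s) Rt.
have [Tv vbad] : S0 v by rewrite -SE; exact: RS.
have {}sv : prefix s v.
  by case/orP: (Tcmp v Tv) => // vs; rewrite (prefix_size_eq vs sv) prefix_refl.
have [R' [R'E R'v]] := prikry_restrict Rt Rv tv.
apply: (vbad v sv (prefix_refl _) 0%N); exists R'; split=> //.
  by rewrite R'E => u [/RS + _]; rewrite SE => -[].
by apply: E_open ER _; rewrite R'E => u [].
Qed.

(** Trees witnessing that the successors of a good node are good are glued
    above it. *)
Lemma good_tree T n t : val T t -> good T n t ->
  exists R, [/\ val R `<=` val T, is_stem U (val R) t &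
    forall v S, val R v -> prefix t v -> size v = (size t + n)%N ->
      val S `<=` [set u | val R u /\ (prefix v u || prefix u v)] -> E S].
Proof.
have [UF _ _] := UP; have [Tinc Tdown] := prikry_treeP T.
elim: n t => [|n IH] t Tt /=.
  move=> [R [RT Rt ER]]; exists R; split=> // v S _ _ _ SR.
  by apply: E_open ER _ => u /SR[].
set A := [set x | _] => UA.
have /choice[Q QP] x : exists R, A x -> [/\ val R `<=` val T,
    is_stem U (val R) (rcons t x) &
    forall v S, val R v -> prefix (rcons t x) v -> size v = (size (rcons t x) + n)%N ->
      val S `<=` [set u | val R u /\ (prefix v u || prefix u v)] -> E S].
  have [[Tx gx]|nA] := pselect (A x); last by exists T.
  by have [R RP] := IH _ Tx gx; exists R.
pose R0 := [set u | prefix u t \/ exists x, [/\ A x, val (Q x) u & prefix (rcons t x) u]].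
have R0T : R0 `<=` val T.
  move=> u [ut|[x [Ax Qu _]]]; first exact: Tdown ut.
  by have [QT _ _] := QP x Ax; exact: QT.
have R0Q x u v : R0 v -> A x -> prefix (rcons t x) v -> val (Q x) v.
  move=> [vt|[y [Ay Qv tyv]]] Ax txv.
    by have := leq_trans (size_prefix txv) (size_prefix vt); rewrite size_rcons ltnn.
  have : rcons t x = rcons t y.
    by apply: prefix_antisym_size txv tyv _; rewrite !size_rcons.
  by move=> /rcons_inj[->].
have R0tree : is_tree R0.
  split=> [u /R0T/Tinc//|u v [vt|[x [Ax Qv txv]]] uv].
    by left; exact: prefix_trans uv vt.
  have [QT [Qx _ _] _] := QP x Ax; have [_ Qdown] := prikry_treeP (Q x).
  case/orP: (prefix_total uv txv) => [|txu].
    by move=> /prefix_rconsP[->|]; [right; exists x; rewrite prefix_refl|left].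
  by right; exists x; split=> //; exact: Qdown uv.
have R0t : R0 t by left; exact: prefix_refl.
have R0A x : A x -> R0 (rcons t x).
  by move=> Ax; right; exists x; have [_ [Qx _ _] _] := QP x Ax; rewrite prefix_refl.
have R0stem : is_stem U R0 t.
  split=> // u.
    move=> [->|[x [_ _ txu]]]; first by rewrite orbT.
    by rewrite (prefix_trans (prefix_rcons _ _) txu).
  move=> [ut|[x [Ax Qu txu]]] tu.
    by rewrite (prefix_size_eq ut (size_prefix tu)); apply: filterS UA => x /R0A.
  have [_ [_ _ Qsplit] _] := QP x Ax.
  apply: filterS (Qsplit u Qu txu) => y Quy; right; exists x; split=> //.
  exact: prefix_trans txu (prefix_rcons _ _).
have [R RE] := @prikry_condP _ _ _ _ _ kl UP R0 t R0tree R0stem.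
exists R; rewrite RE; split=> // v S Rv tv vn SR.
have [x [Ax Qv txv]] : exists x, [/\ A x, val (Q x) v & prefix (rcons t x) v].
  case: Rv => [vt|//]; have := size_prefix vt; rewrite vn.
  by rewrite -{2}[size t]addn0 leq_add2l.
have [_ [Qx _ _] QE] := QP x Ax; have [_ Qdown] := prikry_treeP (Q x).
apply: (QE v S Qv txv); first by rewrite size_rcons vn addSnnS.
move=> u /SR[R0u /orP[vu|uv]]; split; rewrite ?vu ?uv ?orbT //.
  exact: R0Q R0u Ax (prefix_trans txv vu).
exact: Qdown Qv uv.
Qed.

(** The number of steps is the rank of the stem, and the direct extension is the
    tree glued from the witnesses of its goodness. *)
Lemma strong_prikry T s : is_stem U (val T) s ->
  exists n R, [/\ val R `<=` val T, is_stem U (val R) s &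
    forall v S, val R v -> prefix s v -> size v = (size s + n)%N ->
      val S `<=` [set u | val R u /\ (prefix v u || prefix u v)] -> E S].
Proof.
move=> Ts; have [n gn] := stem_good Ts; have [Tss _ _] := Ts.
by have [R RP] := good_tree Tss gn; exists n, R.
Qed.

End StrongPrikry.

(** * From a projection to predistributivity *)

Definition separative (P : forcing) : Prop :=
  forall p q : P, sep_le p q -> fle p q.

Lemma separative_cone_RO (P : forcing) (p : P) : separative P -> cone p \in @RO_cond P.
Proof.
move=> Psep; rewrite inE; split; last by exists p; exact: fle_refl.
apply/seteqP; split=> q.
  move=> pq; apply: Psep => r /pq[s [sr sp]].
  by exists s.
by move=> qp r rq; exists r; split; [exact: fle_refl|exact: fle_trans rq qp].
Qed.

Lemma RO_open (P : forcing) (A : RO P) (p q : P) : val A p -> fle q p -> val A q.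
Proof.
have [Areg _] := set_mem (valP A).
rewrite -{1}Areg => pA qp; rewrite -Areg => r rq; apply: pA.
exact: fle_trans rq qp.
Qed.

Section Predistributive.
Context {d : Order.disp_t} {O : orderType d}.
Variables (kappa lambda : O) (U : set_system (Pk kappa lambda)).
Hypothesis kappa_card : uncountable_cardinal kappa.
Hypothesis kl : kappa <= lambda.
Hypothesis UP : fine_complete_ultrafilter U.
Local Notation PU := (prikry kl UP).
Variable P : forcing.
Hypothesis Psep : separative P.

(** Fewer than [kappa] dense open sets are decided by the levels of one tree, by
    the strong Prikry property; the values of its subtrees at the n-th level
    form the n-th dense set. *)
Lemma projects_predistributive : projects PU (RO P) -> predistributive P kappa.
Proof.
move=> [pi [pi_mono pi1 pi_proj]] p c D ck Ddense; have [UF Uc _] := UP.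
pose conep q : RO P := exist _ (cone q) (separative_cone_RO q Psep).
have pi_cone (T : PU) r : val (pi T) r ->
    exists2 S : PU, val S `<=` val T & val (pi S) `<=` cone r.
  move=> Tr; have [|S ST Sr] := pi_proj T (conep r); last by exists S.
  by move=> q qr; exact: RO_open Tr qr.
have [T _ Tp] : exists2 S : PU, val S `<=` val (fone : PU) & val (pi S) `<=` cone p.
  by apply: pi_cone; rewrite pi1.
have [s Ts] := prikry_stemP T.
have /choice[nR nRP] a : exists nR : nat * PU, a < c ->
    [/\ val nR.2 `<=` val T, is_stem U (val nR.2) s &
    forall v (S : PU), val nR.2 v -> prefix s v -> size v = (size s + nR.1)%N ->
      val S `<=` [set u | val nR.2 u /\ (prefix v u || prefix u v)] ->
      exists2 b, D a b & val (pi S) `<=` cone b].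
  have [ac|nac] := pselect (a < c); last by exists (0%N, T).
  have [_ Dd _] := Ddense a ac.
  have [||n [R RP]] := @strong_prikry _ _ _ _ _ kappa_card kl UP
      [set S : PU | exists2 b, D a b & val (pi S) `<=` cone b] _ _ T s Ts.
  - move=> S S' [b Db S'b] SS'; exists b => //.
    by apply: subset_trans S'b; exact: pi_mono.
  - move=> S; have [_ [r Sr]] := set_mem (valP (pi S)).
    have [b Db br] := Dd r I; have [S' S'S S'b] := pi_cone S b (RO_open Sr br).
    by exists S' => //; exists b.
  by exists (n, R).
have [Tss Tcmp Tsplit] := Ts; have [Tinc Tdown] := prikry_treeP T.
pose W0 := [set u | val T u /\ forall a, a < c -> val (nR a).2 u].
have W0tree : is_tree W0.
  split=> [u [/Tinc//]|u v [Tv Wv] uv]; split; first exact: Tdown uv.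
  move=> a ac; have [_ Rdown] := prikry_treeP (nR a).2.
  exact: Rdown (Wv a ac) uv.
have W0stem : is_stem U W0 s.
  split=> [|u [/Tcmp]//|u [Tu Wu] su].
    by split=> // a ac; have [_ []] := nRP a ac.
  apply: (filterI (Tsplit u Tu su)).
  apply: (complete_forall _ Uc (kappa_card.1 c ck)) => a ac.
  by have [_ [_ _ Rsplit] _] := nRP a ac; apply: Rsplit => //; exact: Wu.
have [W WE] := @prikry_condP _ _ _ _ _ kl UP W0 s W0tree W0stem.
have WT : val W `<=` val T by rewrite WE => u [].
have [_ [q Wq]] := set_mem (valP (pi W)).
pose e n := [set r | fle r q /\ exists (S : PU) t, [/\ val W t, prefix s t,
  size t = (size s + n)%N, val S `<=` [set u | val W u /\ (prefix t u || prefix u t)] &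
  val (pi S) r]].
exists q, e; split=> [|n|a ac].
- by apply: Tp; exact: (pi_mono T W WT).
- split=> [r []//|r rq|r r' [rq [S [t [Wt st tn SW Sr]]]] _ r'r]; last first.
    split; first exact: fle_trans r'r rq.
    by exists S, t; split=> //; exact: RO_open Sr r'r.
  have [S SW Sr] := pi_cone W r (RO_open Wq rq).
  have [s' Ss'] := prikry_stemP S.
  have [v [Sv s'v nv]] := prikry_long_node (size s + n) Ss'.
  have sv : prefix s v.
    case/orP: (Tcmp v (WT v (SW v Sv))) => // vs.
    by rewrite (prefix_size_eq vs) ?prefix_refl // (leq_trans (leq_addr _ _) nv).
  pose t := take (size s + n) v; have tv : prefix t v by exact: prefix_take.
  have tn : size t = (size s + n)%N by rewrite size_takel.
  have st : prefix s t.
    case/orP: (prefix_total sv tv) => // ts.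
    by rewrite (prefix_size_eq ts) ?prefix_refl // tn leq_addr.
  have [S' [S'E S'v]] := prikry_restrict Ss' Sv s'v.
  have [_ [r' S'r']] := set_mem (valP (pi S')).
  have r'r : fle r' r.
    by apply: Sr; apply: (pi_mono S S') S'r'; rewrite /= S'E => u [].
  exists r' => //; split; first exact: fle_trans r'r rq.
  exists S', t; split=> //; first by have [_ Wdown] := prikry_treeP W; exact: Wdown (SW v Sv) tv.
  rewrite S'E => u [Su /orP[vu|uv]]; split; try exact: SW.
    by rewrite (prefix_trans tv vu).
  exact: prefix_total tv uv.
exists (nR a).1 => r [_ [S [t [Wt st tn SW Sr]]]].
have WR : val W `<=` val (nR a).2 by rewrite WE => u [_]; exact.
have [_ _ nRa] := nRP a ac.
have [|b Db Sb] := nRa t S (WR t Wt) st tn.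
  by move=> u /SW[Wu tu]; split=> //; exact: WR.
by have [_ _ Do] := Ddense a ac; apply: (Do b) => //; exact: Sb.
Qed.

End Predistributive.

(** * Separative quotients *)

Section Sepquot.
Variable Q : forcing.

Lemma fle_sep_le (p q : Q) : fle p q -> sep_le p q.
Proof.
by move=> pq r rp; exists r; [exact: fle_refl|exact: fle_trans rp pq].
Qed.

Lemma sepquot_val_equiv (C : sepquot Q) (p q : Q) : val C p -> val C q -> sep_le p q.
Proof.
have [c _ Cc] := set_mem (valP C).
rewrite -Cc => -[_ pc] [cq _]; exact: sep_le_trans pc cq.
Qed.

Lemma sepquot_separative : separative (sepquot Q).
Proof.
move=> C D CD p q Cp Dq r rp.
have rc : sep_class r \in @sepquot_cond Q by rewrite inE; exists r.
pose R : sepquot Q := exist _ (sep_class r) rc.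
have RC : fle R C.
  move=> r' p' [_ r'r] Cp'; apply: sep_le_trans r'r _.
  exact: sep_le_trans (fle_sep_le rp) (sepquot_val_equiv Cp Cp').
have [S SR SD] := CD R RC.
have [s _ Ss] := set_mem (valP S).
have sS : val S s by rewrite -Ss; split; exact: sep_le_refl.
have rR : val R r by split; exact: sep_le_refl.
have [t ts tr] := SR s r sS rR s (fle_refl s).
have [u ut uq] := SD s q sS Dq t ts.
by exists u => //; exact: fle_trans ut tr.
Qed.

Lemma sepquot_card_le : [set: sepquot Q] #<= [set: Q].
Proof.
have : [set: sepquot Q] #= @sepquot_cond Q by exact: card_setT.
rewrite card_eq_le => /andP[/card_le_trans + _]; apply.
exact: card_image_le.
Qed.

End Sepquot.

Theorem theorem1 (d : Order.disp_t) (O : orderType d)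
    (wfO : well_founded (fun a b : O => a < b))
    (kappa lambda mu : O)
    (kappa_card : uncountable_cardinal kappa)
    (lambda_card : is_cardinal lambda)
    (kappa_le_lambda : kappa <= lambda)
    (mu_two_power : is_two_power mu lambda)
    (kappa_compact : strongly_compact kappa mu)
    (Q : forcing) (Q_le_lambda : [set: Q] #<= below lambda) :
  predistributive (sepquot Q) kappa <->
  exists (U : set_system (Pk kappa lambda)) (UP : fine_complete_ultrafilter U),
    projects (prikry kappa_le_lambda UP) (RO (sepquot Q)).
Proof.
have Q_le : [set: sepquot Q] #<= below lambda.
  exact: card_le_trans (sepquot_card_le Q) Q_le_lambda.
split=> [|[U [UP]]]; last first.
  exact: (projects_predistributive kappa_card (@sepquot_separative Q)).
exact: (predistributive_projects wfO kappa_card kappa_le_lambda mu_two_power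
  kappa_compact Q_le).
Qed.
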